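(* Let $d \ge 1$ and let $f$ be an arbitrary probability density on $\mathbb{R}^d$. Let $(r_n)$ be a sequence of positive reals with $\lim_{n\to\infty} n r_n^d = \infty$ and $\lim_{n\to\infty} r_n = 0$. For each $n$, let $X_1,\ldots,X_n$ be i.i.d. with density $f$ and let $G_n$ be the random geometric graph on vertex set $[n]$ in which $\{i,j\}$ ($i\neq j$) is an edge iff $\|X_i - X_j\| \le r_n$ (Euclidean norm). Then there exists an estimator $\Delta_n$ of $d$, computed from the adjacency matrix of $G_n$ alone (without knowledge of $d$, $f$, $r_n$ or the $X_i$; additional independent randomization such as a uniformly random relabeling of the vertices is allowed), such that $\Delta_n \to d$ in probability as $n \to \infty$. *)

(* Defs.v *)
From HB Require Import structures.
From mathcomp Require Import all_boot all_order all_algebra.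
From mathcomp Require Import all_classical all_reals all_analysis.
Set Implicit Arguments. Unset Strict Implicit. Unset Printing Implicit Defensive.
Import Order.TTheory GRing.Theory Num.Theory.
Import numFieldNormedType.Exports.
Local Open Scope classical_set_scope.
Local Open Scope ring_scope.

Fixpoint iterint (R : realType) (T : Type) (I : (T -> \bar R) -> \bar R) (n : nat)
  : (n.-tuple T -> \bar R) -> \bar R :=
  match n return (n.-tuple T -> \bar R) -> \bar R with
  | 0 => fun h => h [tuple]
  | m.+1 => fun h => I (fun x => @iterint R T I m (fun t => h (cons_tuple x t)))
  end.

(* Lebesgue integral on R^d (points of R^d are d.-tuples of reals), of a
   nonnegative function, defined as the iterated one-dimensional Lebesgue
   integral (Tonelli). *)
Definition lebint (R : realType) (d : nat) (g : d.-tuple R -> \bar R) : \bar R :=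
  @iterint R R (fun h : R -> \bar R => (\int[@lebesgue_measure R]_x h x)%E) d g.

Definition is_density (R : realType) (d : nat) (f : d.-tuple R -> R) : Prop :=
  [/\ forall x, 0 <= f x, measurable_fun [set: d.-tuple R] f
    & lebint (fun x => (f x)%:E) = 1%E].

Definition eucl_dist (R : realType) (d : nat) (x y : d.-tuple R) : R :=
  Num.sqrt (\sum_(k < d) (tnth x k - tnth y k) ^+ 2).

Definition rgg_adj (R : realType) (n d : nat) (r : R) (xs : n.-tuple (d.-tuple R))
  : 'M[bool]_n :=
  \matrix_(i < n, j < n) ((i != j) && (eucl_dist (tnth xs i) (tnth xs j) <= r)).

Definition iid_expect (R : realType) (n d : nat) (f : d.-tuple R -> R)
  (h : n.-tuple (d.-tuple R) -> \bar R) : \bar R :=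
  @iterint R (d.-tuple R) (fun g : d.-tuple R -> \bar R => lebint (fun x => g x * (f x)%:E)%E) n h.

(* Probability that the (randomized) estimator Delta, applied to the RGG with
   n i.i.d. f-distributed points and radius r, deviates from t by more than
   eps. The auxiliary randomness is a uniform element u of 'I_K.+1,
   independent of the points. *)
Definition dev_prob (R : realType) (n d K : nat) (f : d.-tuple R -> R) (r : R)
  (Delta : 'I_K.+1 -> 'M[bool]_n -> R) (t eps : R) : \bar R :=
  ((K.+1%:R)^-1%:E *
   \sum_(u < K.+1)
     @iid_expect R n d f
       (fun xs => (if eps < `|Delta u (rgg_adj r xs) - t| then 1 else 0)%:E))%E.

(* Main.v *)
Require Import Defs.
From HB Require Import structures.
From mathcomp Require Import all_boot all_order all_algebra.
From mathcomp Require Import all_classical all_reals all_analysis.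
From mathcomp Require Import measurable_realfun.
From mathcomp Require Import ring lra.
Import Order.TTheory GRing.Theory Num.Theory.
Import numFieldNormedType.Exports.
Set Implicit Arguments. Unset Strict Implicit. Unset Printing Implicit Defensive.
Local Open Scope classical_set_scope.
Local Open Scope ring_scope.

(** Let M(d) be the largest number of points of the closed unit ball of R^d at
    pairwise distances greater than 1. It is finite (pigeonhole on a grid) and
    strictly increasing in d >= 1, since the new basis vector can be added to a
    packing that has at least two points. The estimator is the d for which M(d)
    is the largest number of leaves of an induced star of the graph. Rescaling
    an induced star by r_n gives a packing, so M(d) is never exceeded. Conversely
    an optimal packing can be shrunk so as to tolerate small perturbations; if
    each of the M(d) + 1 boxes x + r_n Q_i around its points and its centre
    contains a sample point, then the graph has an induced star with M(d) leaves.
    It remains to find, for each small r, a point x such that all these boxes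
    have mass at least c r^d: the probability of missing one of them is then at
    most (M(d) + 1) / (1 + n c r_n^d). Such an x exists by averaging over a set A
    with f >= c on A and finite positive measure, because the measure of
    A \ (A - v) tends to 0 as v tends to 0; this follows from the
    one-dimensional case by induction on d, translating one coordinate at a
    time. *)

(** * Lebesgue measure on tuples *)

(* The integral of a nonnegative function is a supremum over the simple functions
   below it, hence monotone without measurability; the deviation event is never
   shown to be measurable. *)
Lemma le_integral_ge0 (R : realType) d (T : measurableType d)
    (mu : {measure set T -> \bar R}) (f g : T -> \bar R) :
  (forall x, 0 <= f x)%E -> (forall x, f x <= g x)%E ->
  (\int[mu]_x f x <= \int[mu]_x g x)%E.
Proof.
move=> f0 fg.
have g0 x : (0 <= g x)%E by exact: le_trans (fg x).
rewrite !ge0_integralTE//; apply: ereal_sup_le => _ /= [h hf <-].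
by exists h => // x; exact: le_trans (fg x).
Qed.

Lemma measurable_cons_pair (R : realType) d :
  measurable_fun [set: R * d.-tuple R] (fun p => cons_tuple p.1 p.2).
Proof.
exact: (measurable_cons (@measurable_fst _ _ _ _) (@measurable_snd _ _ _ _)).
Qed.

Lemma measurable_cons_r (R : realType) d (x : R) :
  measurable_fun [set: d.-tuple R] (fun t => cons_tuple x t).
Proof. exact: (measurable_cons (@measurable_cst _ _ _ _ _ x) (@measurable_id _ _ _)). Qed.

(** The product measure is pushed forward along [phi], so Tonelli on the product becomes a formula
    on [T3]. It stays sigma-finite because two increasing exhaustions give rectangles that exhaust
    the product, and [psi] pulls them back. *)
Lemma product_measure_bij d1 d2 d3 (T1 : measurableType d1)
    (T2 : measurableType d2) (T3 : measurableType d3) (R : realType)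
    (m1 : {sigma_finite_measure set T1 -> \bar R})
    (m2 : {sigma_finite_measure set T2 -> \bar R})
    (phi : T1 * T2 -> T3) (psi : T3 -> T1 * T2) :
  measurable_fun setT phi -> measurable_fun setT psi ->
  cancel phi psi -> cancel psi phi ->
  exists nu : {sigma_finite_measure set T3 -> \bar R},
    forall g : T3 -> \bar R, measurable_fun setT g -> (forall x, 0 <= g x)%E ->
    (\int[nu]_x g x = \int[m1]_x \int[m2]_y g (phi (x, y)))%E.
Proof.
move=> mphi mpsi phiK psiK.
pose mf := HB.pack phi (isMeasurableFun.Build _ _ _ _ phi mphi) :
  {mfun (T1 * T2)%type >-> T3}.
pose nu := pushforward (m1 \x m2)%E mf.
have snu : sigma_finite setT nu.
  have /sigma_finiteP[F [TF ndF Foo]] := sigma_finiteT m1.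
  have /sigma_finiteP[G [TG ndG Goo]] := sigma_finiteT m2.
  exists (fun i => psi @^-1` (F i `*` G i)).
    apply/esym; rewrite -subTset => z _.
    have [i _ Fi] : (\bigcup_i F i) (psi z).1 by rewrite -TF.
    have [j _ Gj] : (\bigcup_j G j) (psi z).2 by rewrite -TG.
    exists (maxn i j) => //; split=> /=.
      by move: Fi; exact/subsetPset/ndF/leq_maxl.
    by move: Gj; exact/subsetPset/ndG/leq_maxr.
  move=> i; have [mF Fi] := Foo i; have [mG Gi] := Goo i; split.
    by rewrite -[_ @^-1` _]setTI; apply: mpsi => //; exact: measurableX.
  rewrite /nu /pushforward -comp_preimage (_ : psi \o phi = id); last exact/funext.
  rewrite preimage_id product_measure1E//.
  by rewrite lte_mul_pinfty// ge0_fin_numE.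
pose nu' := HB.pack nu (Measure_isSigmaFinite.Build _ _ _ nu snu) :
  {sigma_finite_measure set T3 -> \bar R}.
exists (nu' mphi mphi mphi) => g mg g0.
rewrite [LHS](@ge0_integral_pushforward _ _ _ _ _ phi mphi (m1 \x m2)%E)//.
by rewrite preimage_setT fubini_tonelli1//=; exact: measurableT_comp.
Qed.

(** Gives access to measure theory for [lebint], an iteration defined on all functions. By induction
    on the dimension: the Dirac mass at the empty tuple, then products with Lebesgue measure on the
    line. *)
Lemma lebint_measure (R : realType) d :
  exists mu : {sigma_finite_measure set (d.-tuple R) -> \bar R},
    forall g : d.-tuple R -> \bar R, measurable_fun [set: d.-tuple R] g ->
    (forall x, (0 <= g x)%E) ->
    lebint g = (\int[mu]_x g x)%E.
Proof.
elim: d => [|d [mu IH]].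
  exists (\d_([tuple] : 0.-tuple R)).
  move=> g mg g0; rewrite integral_dirac// diracE in_setT mul1e//.
pose psi (t : d.+1.-tuple R) : measurableTypeR R * d.-tuple R :=
  (tnth t ord0, [tuple of behead t]).
have mpsi : measurable_fun setT psi.
  by apply: measurable_fun_pair; [exact: measurable_tnth|exact: measurable_behead].
have [||nu nuE] := product_measure_bij (@lebesgue_measure R) mu
  (@measurable_cons_pair R d) mpsi.
- by move=> [a b]; congr pair; apply: val_inj.
- by move=> t; exact/esym/tuple_eta.
exists nu => g mg g0; rewrite nuE//.
rewrite /lebint/=; apply: eq_integral => x _.
by rewrite -IH//; apply: measurableT_comp => //; exact: measurable_cons_r.
Qed.

Definition lebd (R : realType) d : {sigma_finite_measure set (d.-tuple R) -> \bar R} :=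
  projT1 (cid (lebint_measure R d)).

Lemma lebintE (R : realType) d (g : d.-tuple R -> \bar R) :
  measurable_fun [set: d.-tuple R] g -> (forall x, 0 <= g x)%E ->
  lebint g = (\int[lebd R d]_x g x)%E.
Proof. exact: (projT2 (cid (lebint_measure R d))). Qed.

Lemma integral_lebdS (R : realType) d (g : d.+1.-tuple R -> \bar R) :
  measurable_fun [set: d.+1.-tuple R] g -> (forall x, 0 <= g x)%E ->
  (\int[lebd R d.+1]_x g x =
   \int[@lebesgue_measure R]_x \int[lebd R d]_y g (cons_tuple x y))%E.
Proof.
move=> mg g0; rewrite -lebintE//=; apply: eq_integral => x _.
by rewrite -lebintE//; apply: measurableT_comp => //; exact: measurable_cons_r.
Qed.

(** With the first coordinate integrated innermost, sections become subsets of the line, where the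
    one-dimensional translation results apply. *)
Lemma integral_lebdSr (R : realType) d (g : d.+1.-tuple R -> \bar R) :
  measurable_fun [set: d.+1.-tuple R] g -> (forall x, 0 <= g x)%E ->
  (\int[lebd R d.+1]_x g x =
   \int[lebd R d]_y \int[@lebesgue_measure R]_x g (cons_tuple x y))%E.
Proof.
move=> mg g0; rewrite integral_lebdS//.
apply: (@fubini_tonelli _ _ _ _ _ (@lebesgue_measure R) (lebd R d)
  (fun p => g (cons_tuple p.1 p.2))) => //.
by apply: measurableT_comp => //; exact: measurable_cons_pair.
Qed.

Section sections.
Context (R : realType) (d : nat) (A : set (d.+1.-tuple R)).
Hypothesis mA : measurable A.

Let E : set (measurableTypeR R * d.-tuple R) :=
  (fun p => cons_tuple p.1 p.2) @^-1` A.

Let mE : measurable E.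
Proof. by rewrite -[E]setTI; exact: (@measurable_cons_pair R d). Qed.

Let xsecE x : xsection E x = cons_tuple x @^-1` A.
Proof. by apply/seteqP; split => y; rewrite /xsection /= inE. Qed.

Let ysecE y : ysection E y = (fun x => cons_tuple x y) @^-1` A.
Proof. by apply/seteqP; split => x; rewrite /ysection /= inE. Qed.

Lemma measurable_consl x : measurable (cons_tuple x @^-1` A).
Proof. by rewrite -xsecE; exact: measurable_xsection. Qed.

Lemma measurable_consr y :
  measurable (((fun x => cons_tuple x y) @^-1` A) : set (measurableTypeR R)).
Proof. by rewrite -ysecE; exact: measurable_ysection. Qed.

Lemma measurable_fun_consl :
  measurable_fun [set: measurableTypeR R] (fun x => lebd R d (cons_tuple x @^-1` A)).
Proof.
rewrite (_ : (fun _ => _) = lebd R d \o xsection E).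
  exact: measurable_fun_xsection.
by apply/funext => x /=; rewrite xsecE.
Qed.

Lemma measurable_fun_consr :
  measurable_fun [set: d.-tuple R]
    (fun y => @lebesgue_measure R ((fun x => cons_tuple x y) @^-1` A)).
Proof.
rewrite (_ : (fun _ => _) = @lebesgue_measure R \o ysection E).
  exact: (@measurable_fun_ysection _ _ _ _ _ (@lebesgue_measure R)).
by apply/funext => x /=; rewrite ysecE.
Qed.

Lemma lebdS :
  lebd R d.+1 A = (\int[@lebesgue_measure R]_x lebd R d (cons_tuple x @^-1` A))%E.
Proof.
rewrite -[in LHS](setIT A) -integral_indic// integral_lebdS//.
- apply: eq_integral => x _; rewrite -[in RHS](setIT (_ @^-1` _)) -integral_indic//.
  exact: measurable_consl.
- exact/measurable_EFinP/measurable_indic.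
Qed.

Lemma lebdSr :
  lebd R d.+1 A =
  (\int[lebd R d]_y @lebesgue_measure R ((fun x => cons_tuple x y) @^-1` A))%E.
Proof.
rewrite -[in LHS](setIT A) -integral_indic// integral_lebdSr//.
- apply: eq_integral => x _; rewrite -[in RHS](setIT (_ @^-1` _)) -integral_indic//.
  exact: measurable_consr.
- exact/measurable_EFinP/measurable_indic.
Qed.

End sections.

(** The image of Lebesgue measure under a translation gives half-open intervals their length, which
    characterizes Lebesgue measure. *)
Lemma lebesgue_measure_shift (R : realType) (a : R) (A : set R) : measurable A ->
  @lebesgue_measure R [set x | A (x + a)] = @lebesgue_measure R A.
Proof.
move=> mA; pose f (x : measurableTypeR R) : measurableTypeR R := x + a.
have mf : measurable_fun setT f by exact: measurable_funD.
pose mf' := HB.pack f (isMeasurableFun.Build _ _ _ _ f mf) :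
  {mfun measurableTypeR R >-> measurableTypeR R}.
pose nu := pushforward (@lebesgue_measure R) mf'.
apply/esym/(@lebesgue_measure_unique _ nu) => //.
move=> _ [[u v] _ <-] /=; rewrite /nu /pushforward /=.
rewrite (_ : f @^-1` _ = [set` `]u - a, v - a]]); last first.
  apply/seteqP; split => x /=; rewrite !in_itv/= /f; lra.
by rewrite !lebesgue_measure_itv/= !lte_fin ltrD2r -!EFinB opprB addrA subrK.
Qed.

(** * Continuity of translations *)

(** Dominated convergence. Pointwise convergence is asked only where [g] is finite, because sections
    of a set of finite measure have finite measure only almost everywhere. *)
Lemma integral_cvg0 (R : realType) d (T : measurableType d)
    (mu : {measure set T -> \bar R}) (f : nat -> T -> \bar R) (g : T -> \bar R) :
  (forall n, measurable_fun setT (f n)) -> measurable_fun setT g ->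
  (forall n x, 0 <= f n x)%E -> (forall n x, f n x <= g x)%E ->
  (\int[mu]_x g x < +oo)%E ->
  (forall x, (g x < +oo)%E -> f ^~ x @ \oo --> 0%E) ->
  (fun n => \int[mu]_x f n x)%E @ \oo --> 0%E.
Proof.
move=> mf mg f0 fg goo fcvg.
have g0 x : (0 <= g x)%E by exact: le_trans (fg 0 x).
have ig : mu.-integrable setT g.
  apply/integrableP; split => //.
  by under eq_integral do rewrite gee0_abs//.
have [||_ _] := @dominated_convergence _ _ _ mu setT measurableT f (cst 0%E) g mf
  (measurable_cst _) _ ig _; last by rewrite integral0.
- have := integrable_ae measurableT ig; apply: filterS => x /= gx _.
  by apply: fcvg; rewrite -ge0_fin_numE//; exact: gx.
- by apply: nearW => x n _; rewrite gee0_abs.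
Qed.

Lemma nneg_cvg0P (R : realType) (u : nat -> \bar R) : (forall n, 0 <= u n)%E ->
  (u @ \oo --> 0%E <-> forall e : R, 0 < e -> \forall n \near \oo, (u n <= e%:E)%E).
Proof.
move=> u0; split.
  move=> /fine_cvgP[ufin /cvgrPdist_le ucvg] e e0.
  near=> n; have un : u n \is a fin_num by near: n.
  rewrite -(fineK un) lee_fin.
  have : `|0 - fine (u n)| <= e by near: n; exact: ucvg.
  by rewrite sub0r normrN ger0_norm// fine_ge0.
move=> H; apply/fine_cvgP; split.
  near=> n; rewrite ge0_fin_numE//; apply: (@le_lt_trans _ _ 1%:E); last exact: ltry.
  by near: n; exact: H.
apply/cvgrPdist_le => e e0; near=> n.
rewrite sub0r normrN ger0_norm ?fine_ge0//.
have un : (u n <= e%:E)%E by near: n; exact: H.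
rewrite -lee_fin fineK// ge0_fin_numE//; exact: le_lt_trans (ltry e).
Unshelve. all: by end_near. Qed.

(** Take an open [U] containing [A] with [U \ A] of measure below e/2. A point of [A] whose
    translate leaves [A] either leaves [U], which by openness eventually fails at each point, or
    lands in [U \ A], which costs less than e/2 by translation invariance. *)
Lemma lebesgue_shift_cvg (R : realType) (A : set R) (s : nat -> R) :
  measurable A -> (@lebesgue_measure R A < +oo)%E -> s @ \oo --> 0 ->
  (fun n => @lebesgue_measure R (A `\` [set x | A (x + s n)])) @ \oo --> 0%E.
Proof.
move=> mA Aoo scvg.
have mS (B : set R) a : measurable B -> measurable [set x : R | B (x + a)].
  move=> mB; have mf : measurable_fun setT (fun x : R => x + a) by exact: measurable_funD.
  by rewrite -[X in measurable X]setTI; exact: mf.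
apply/nneg_cvg0P => [n|e e0]; first exact: measure_ge0.
have [U [oU AU Ue]] := lebesgue_regularity_outer mA Aoo (divr_gt0 e0 (ltr0n R 2)).
have mU : measurable U by exact: open_measurable.
pose P n := A `\` [set x | U (x + s n)].
have mP n : measurable (P n) by apply: measurableD => //; exact: mS.
have Pcvg : (fun n => @lebesgue_measure R (P n)) @ \oo --> 0%E.
  rewrite (_ : (fun _ => _) =
      (fun n => \int[@lebesgue_measure R]_x (\1_(P n) x)%:E)%E); last first.
    apply/funext => n; rewrite integral_indic;
      [by rewrite setIT|exact: measurableT|exact: mP].
  apply: (@integral_cvg0 _ _ _ (@lebesgue_measure R) (fun n x => (\1_(P n) x)%:E)
    (fun x => (\1_A x)%:E)).
  - by move=> n; apply/measurable_EFinP/measurable_indic; exact: mP.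
  - by apply/measurable_EFinP/measurable_indic; exact: mA.
  - by move=> n x; rewrite lee_fin.
  - move=> n x; rewrite lee_fin !indicE ler_nat.
    by have [/set_mem[Ax _]|//] := boolP (x \in P n); rewrite mem_set.
  - by rewrite integral_indic ?setIT.
  - move=> x _; apply: cvg_near_cst.
    have [Ax|nAx] := pselect (A x); last first.
      by apply: nearW => n; rewrite indicE memNset// => -[].
    have : (fun n => x + s n) @ \oo --> x + 0 by apply: cvgD => //; exact: cvg_cst.
    rewrite addr0 => xs.
    have Ux : nbhs x U by apply: open_nbhs_nbhs; split=> //; exact: AU.
    have : \forall n \near \oo, U (x + s n) := xs _ Ux.
    by apply: filterS => n Un; rewrite indicE memNset// => -[].
move/nneg_cvg0P : Pcvg => /(_ (fun=> measure_ge0 _ _) _ (divr_gt0 e0 (ltr0n R 2))).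
apply: filterS => n Pn.
have -> : e%:E = ((e / 2)%:E + (e / 2)%:E)%E by rewrite -EFinD -splitr.
pose Q := [set x | (U `\` A) (x + s n)].
have mQ : measurable Q by apply: (mS (U `\` A)); exact: measurableD.
apply: (@le_trans _ _ (@lebesgue_measure R (P n `|` Q))).
  apply: le_measure; rewrite ?inE.
  - exact: (measurableD mA (mS _ _ mA)).
  - exact: (measurableU _ _ (mP n) mQ).
  - move=> x [Ax nA]; have [Ux|nUx] := pselect (U (x + s n)).
      by right; split.
    by left; split.
apply: (le_trans (@measureU2 _ _ _ (@lebesgue_measure R) _ _ (mP n) mQ)).
apply: leeD; first exact: Pn.
have QE : @lebesgue_measure R Q = @lebesgue_measure R (U `\` A).
  by apply: (@lebesgue_measure_shift _ _ (U `\` A)); exact: measurableD.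
by apply: le_trans (ltW Ue); rewrite [leLHS]QE.
Qed.

Definition tadd (R : realType) d (x v : d.-tuple R) : d.-tuple R :=
  [tuple tnth x k + tnth v k | k < d].

Lemma tadd_cons (R : realType) d (a b : R) (x v : d.-tuple R) :
  tadd (cons_tuple a x) (cons_tuple b v) = cons_tuple (a + b) (tadd x v).
Proof.
apply: eq_from_tnth => k; rewrite tnth_mktuple.
case: (unliftP ord0 k) => [j|] ->; first by rewrite !tnthS tnth_mktuple.
by rewrite !tnth0.
Qed.

Lemma tadd_zero (R : realType) d (x : d.-tuple R) : tadd x [tuple 0 | _ < d] = x.
Proof. by apply: eq_from_tnth => k; rewrite !tnth_mktuple addr0. Qed.

Lemma taddA (R : realType) d (x v w : d.-tuple R) : tadd (tadd x v) w = tadd x (tadd v w).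
Proof. by apply: eq_from_tnth => k; rewrite !tnth_mktuple addrA. Qed.

Lemma measurable_tadd2 (R : realType) d :
  measurable_fun [set: d.-tuple R * d.-tuple R] (fun p => tadd p.1 p.2).
Proof.
apply/measurable_fun_tnthP => k.
rewrite (_ : _ \o _ = (fun p : d.-tuple R * d.-tuple R => tnth p.1 k + tnth p.2 k)).
  apply: measurable_funD.
  - by apply: (measurableT_comp (measurable_tnth k)).
  - by apply: (measurableT_comp (measurable_tnth k)).
by apply/funext => p /=; rewrite tnth_mktuple.
Qed.

Lemma measurable_tadd (R : realType) d (v : d.-tuple R) :
  measurable_fun [set: d.-tuple R] (fun x => tadd x v).
Proof.
apply/measurable_fun_tnthP => k.
rewrite (_ : _ \o _ = (fun x : d.-tuple R => tnth x k + tnth v k)).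
  by apply: measurable_funD => //; exact: measurable_tnth.
by apply/funext => p /=; rewrite tnth_mktuple.
Qed.

Lemma measurable_shift (R : realType) d (v : d.-tuple R) (A : set (d.-tuple R)) :
  measurable A -> measurable [set x | A (tadd x v)].
Proof. by move=> mA; rewrite -[X in measurable X]setTI; exact: measurable_tadd. Qed.

Lemma cons_tuple_eta (T : Type) d (v : d.+1.-tuple T) :
  v = cons_tuple (thead v) [tuple of behead v].
Proof. by rewrite {1}(tuple_eta v); apply: val_inj. Qed.

(** Splits a translation into one along the first coordinate and one along the others, so that each
    acts on sections. *)
Lemma tadd_consr (R : realType) d (b : R) (v : d.-tuple R) :
  cons_tuple b v = tadd (cons_tuple b [tuple 0 | _ < d]) (cons_tuple 0 v).
Proof.
rewrite tadd_cons addr0; congr cons_tuple.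
by apply: eq_from_tnth => k; rewrite !tnth_mktuple add0r.
Qed.

Lemma lebd_shift (R : realType) d (v : d.-tuple R) (A : set (d.-tuple R)) :
  measurable A -> lebd R d [set x | A (tadd x v)] = lebd R d A.
Proof.
elim: d v A => [|d IH] v A mA.
  by congr (lebd R 0 _); apply/seteqP; split=> x /=;
    rewrite !(tuple0 (tadd _ _)) (tuple0 x).
rewrite (cons_tuple_eta v); move: (thead v) [tuple of behead v] => b w.
pose B := [set x | A (tadd x (cons_tuple 0 w))].
have mB : measurable B by exact: measurable_shift.
transitivity (lebd R d.+1 [set x | B (tadd x (cons_tuple b [tuple 0 | _ < d]))]).
  congr (lebd R d.+1 _); apply/seteqP; split=> x /=.
    by rewrite /B/= taddA -tadd_consr.
  by rewrite /B/= taddA -tadd_consr.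
rewrite lebdSr; last exact: measurable_shift.
transitivity (lebd R d.+1 B).
  rewrite lebdSr//; apply: eq_integral => y _.
  rewrite -(@lebesgue_measure_shift R b _ (measurable_consr mB y)).
  congr (lebesgue_measure _); apply/seteqP; split=> x /=; by rewrite tadd_cons tadd_zero.
rewrite !lebdS//; apply: eq_integral => x _.
rewrite -(IH w (cons_tuple x @^-1` A)); last exact: measurable_consl.
by congr (lebd R d _); apply/seteqP; split=> y /=; rewrite /B/= tadd_cons addr0.
Qed.

(** [P n] and [Q n] are the losses under the partial translations [sh0] (last coordinates) and [sh1]
    (first coordinate). Both tend to 0 by dominated convergence over sections, using the induction
    hypothesis for [P n] and the one-dimensional case for [Q n]. *)
Lemma lebd_shift_cvg (R : realType) d (A : set (d.-tuple R)) (v : nat -> d.-tuple R) :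
  measurable A -> (lebd R d A < +oo)%E ->
  (forall k, (fun n => tnth (v n) k) @ \oo --> 0) ->
  (fun n => lebd R d (A `\` [set x | A (tadd x (v n))])) @ \oo --> 0%E.
Proof.
elim: d A v => [|d IH] A v mA Aoo vcvg.
  apply: cvg_near_cst; apply: nearW => n.
  rewrite (_ : _ `\` _ = set0) ?measure0//; apply/seteqP; split=> // x [Ax] /=.
  by case; rewrite (tuple0 (tadd _ _)) -(tuple0 x).
pose b n := thead (v n); pose w n := [tuple of behead (v n)].
have vE n : v n = cons_tuple (b n) (w n) by rewrite -cons_tuple_eta.
pose sh0 n z := tadd z (cons_tuple 0 (w n)).
pose sh1 n z := tadd z (cons_tuple (b n) [tuple 0 | _ < d]).
pose P n := A `\` [set z | A (sh0 n z)].
pose Q n := A `\` [set z | A (sh1 n z)].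
have mP n : measurable (P n) by apply: measurableD => //; exact: measurable_shift.
have mQ n : measurable (Q n) by apply: measurableD => //; exact: measurable_shift.
have Pcvg : (fun n => lebd R d.+1 (P n)) @ \oo --> 0%E.
  rewrite (_ : (fun _ => _) =
    (fun n => \int[@lebesgue_measure R]_x lebd R d (cons_tuple x @^-1` (P n)))%E); last first.
    by apply/funext => n; rewrite lebdS.
  apply: (@integral_cvg0 _ _ _ (@lebesgue_measure R)
    (fun n x => lebd R d (cons_tuple x @^-1` (P n)))
    (fun x => lebd R d (cons_tuple x @^-1` A))).
  - by move=> n; exact: measurable_fun_consl.
  - exact: measurable_fun_consl.
  - by move=> n x; exact: measure_ge0.
  - move=> n x; apply: le_measure; rewrite ?inE; [exact: measurable_consl..|].
    by move=> y [].
  - by rewrite -lebdS.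
  - move=> x xoo.
    rewrite (_ : (fun _ => _) = (fun n => lebd R d ((cons_tuple x @^-1` A) `\`
      [set y | (cons_tuple x @^-1` A) (tadd y (w n))]))).
      apply: IH => // [|k]; first exact: measurable_consl.
      rewrite (_ : (fun _ => _) = (fun n => tnth (v n) (lift ord0 k))); first exact: vcvg.
      by apply/funext => n; rewrite vE tnthS.
    apply/funext => n; congr (lebd R d _).
    by apply/seteqP; split=> y; rewrite /P /sh0 /= tadd_cons addr0.
have Qcvg : (fun n => lebd R d.+1 (Q n)) @ \oo --> 0%E.
  rewrite (_ : (fun _ => _) =
    (fun n => \int[lebd R d]_y
       @lebesgue_measure R ((fun x => cons_tuple x y) @^-1` (Q n)))%E); last first.
    by apply/funext => n; rewrite lebdSr.
  apply: (@integral_cvg0 _ _ _ (lebd R d)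
    (fun n y => @lebesgue_measure R ((fun x => cons_tuple x y) @^-1` (Q n)))
    (fun y => @lebesgue_measure R ((fun x => cons_tuple x y) @^-1` A))).
  - by move=> n; exact: measurable_fun_consr.
  - exact: measurable_fun_consr.
  - by move=> n x; exact: measure_ge0.
  - move=> n x; apply: le_measure; rewrite ?inE; [exact: measurable_consr..|].
    by move=> y [].
  - by rewrite -lebdSr.
  - move=> y yoo.
    rewrite (_ : (fun _ => _) = (fun n =>
      @lebesgue_measure R (((fun x => cons_tuple x y) @^-1` A) `\`
      [set x | ((fun x => cons_tuple x y) @^-1` A) (x + b n)]))).
      apply: lebesgue_shift_cvg => //; first exact: measurable_consr.
      rewrite (_ : b = (fun n => tnth (v n) ord0)); first exact: vcvg.
      by apply/funext => n; rewrite vE tnth0.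
    apply/funext => n; congr (lebesgue_measure _).
    by apply/seteqP; split=> x; rewrite /Q /sh1 /= tadd_cons tadd_zero.
apply: (@squeeze_cvge _ _ _ _ (cst 0%E) _
  (fun n => lebd R d.+1 (P n) + lebd R d.+1 (Q n))%E).
- apply: nearW => n; rewrite measure_ge0/=.
  have mQ' : measurable [set z | Q n (sh0 n z)] by exact: measurable_shift.
  have <- : lebd R d.+1 [set z | Q n (sh0 n z)] = lebd R d.+1 (Q n).
    by rewrite /sh0 lebd_shift.
  apply: (le_trans _ (@measureU2 _ _ _ (lebd R d.+1) _ _ (mP n) mQ')).
  apply: le_measure; rewrite ?inE.
  + by apply: measurableD => //; exact: measurable_shift.
  + exact: measurableU.
  (* Translate in two stages: [x] leaves [A] at the first stage, so it is in [P n], or at the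
     second, so [sh0 n x] is in [Q n]. *)
  + move=> x [Ax nA]; have [Ux|nUx] := pselect (A (sh0 n x)); last by left; split.
    right; split => //=; apply: contra_not nA => /=.
    by rewrite /sh1 /sh0 taddA tadd_cons add0r tadd_zero -vE.
- exact: cvg_cst.
- by rewrite -[X in _ --> X](adde0 0%E); apply: cvgeD.
Qed.

(** * Boxes and a weak density theorem *)

Definition box (R : realType) d (c : d.-tuple R) (s : R) : set (d.-tuple R) :=
  [set y | forall k, `|tnth y k - tnth c k| <= s].

Lemma measurable_box (R : realType) d (c : d.-tuple R) (s : R) : measurable (box c s).
Proof.
rewrite (_ : box c s = \bigcap_(k in [set: 'I_d])
    ((fun y => tnth y k) @^-1` [set` `[tnth c k - s, tnth c k + s]])); last first.
  apply/seteqP; split=> y /= H k; first by move=> _; rewrite /= in_itv/= -ler_distl.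
  by have := H k I; rewrite /= in_itv/= -ler_distl.
apply: fin_bigcap_measurable => // k _; rewrite -[X in measurable X]setTI.
by apply: measurable_tnth.
Qed.

Lemma lebd_box (R : realType) d (c : d.-tuple R) (s : R) : 0 <= s ->
  lebd R d (box c s) = ((2 * s) ^+ d)%:E.
Proof.
move=> s0; elim: d c => [|d IH] c.
  rewrite expr0 (_ : box c s = setT); last by apply/seteqP; split=> // y _ [].
  rewrite -[LHS]mul1e -integral_cst//.
  by rewrite -(@lebintE R 0 (cst 1%E)).
rewrite lebdS; last exact: measurable_box.
rewrite (cons_tuple_eta c); move: (thead c) [tuple of behead c] => a {}c.
pose I := `[a - s, a + s].
have mI : measurable [set` I] by exact: measurable_itv.
transitivity (\int[@lebesgue_measure R]_x (((2 * s) ^+ d)%:E * (\1_[set` I] x)%:E))%E.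
  apply: eq_integral => x _; rewrite indicE.
  have [xI|xI] := boolP (x \in [set` I]).
    rewrite mule1 -(IH c); congr (lebd R d _); apply/seteqP; split=> y /= H k.
      by have := H (lift ord0 k); rewrite !tnthS.
    case: (unliftP ord0 k) => [j|] ->; first by rewrite !tnthS.
    by rewrite !tnth0; move/set_mem : xI; rewrite /= in_itv/= -ler_distl.
  rewrite mule0 (_ : _ @^-1` _ = set0) ?measure0//; apply/seteqP; split=> // y /= H.
  move/negP : xI; apply; rewrite inE /= in_itv/= -ler_distl.
  by have := H ord0; rewrite !tnth0.
pose g : measurableTypeR R -> R := \1_[set` I].
have mg : measurable_fun setT g by apply: measurable_indic; exact: mI.
have m1 : measurable_fun setT (EFin \o g) by apply/measurable_EFinP.
rewrite (@ge0_integralZl _ _ _ (@lebesgue_measure R) setT measurableT _ m1); last 2 first.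
- by move=> x _; rewrite lee_fin.
- by rewrite lee_fin exprn_ge0// mulr_ge0.
have -> : (\int[@lebesgue_measure R]_x (EFin \o g) x = @lebesgue_measure R [set` I])%E.
  by rewrite integral_indic ?setIT.
rewrite [@lebesgue_measure R _]lebesgue_measure_itv/= lte_fin; case: ltP => as_.
  rewrite -EFinB -EFinM exprSr; congr (_%:E); ring.
(* A degenerate interval means [s = 0], and both sides vanish. *)
by have -> : s = 0; [lra|rewrite mule0 mulr0 exprS mul0r].
Qed.

Lemma integral_section_swap d1 d2 (T1 : measurableType d1) (T2 : measurableType d2)
    (R : realType) (m1 : {sigma_finite_measure set T1 -> \bar R})
    (m2 : {sigma_finite_measure set T2 -> \bar R}) (E : set (T1 * T2)) :
  measurable E ->
  (\int[m1]_x m2 [set y | E (x, y)] = \int[m2]_y m1 [set x | E (x, y)])%E.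
Proof.
move=> mE; pose g (z : T1 * T2) : \bar R := (\1_E z)%:E.
have mg : measurable_fun setT g by exact/measurable_EFinP/measurable_indic.
transitivity (\int[m1]_x \int[m2]_y g (x, y))%E.
  apply: eq_integral => x _; rewrite -[in LHS](setIT [set y | E (x, y)]).
  rewrite -integral_indic//.
  by have := measurable_xsection x mE; rewrite xsectionE.
rewrite fubini_tonelli//; last by move=> z; rewrite lee_fin.
apply: eq_integral => y _; rewrite -[in RHS](setIT [set x | E (x, y)]).
rewrite -integral_indic//.
by have := measurable_ysection y mE; rewrite ysectionE.
Qed.

Lemma taddC (R : realType) d (x v : d.-tuple R) : tadd x v = tadd v x.
Proof. by apply: eq_from_tnth => k; rewrite !tnth_mktuple addrC. Qed.

(** Uniform version of [lebd_shift_cvg]: if no [rho] worked, bad vectors with coordinates at most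
    1/(n+1) would form a sequence tending to 0. *)
Lemma lebd_shift_small (R : realType) d (A : set (d.-tuple R)) (e : R) :
  measurable A -> (lebd R d A < +oo)%E -> 0 < e ->
  exists2 rho : R, 0 < rho & forall v, (forall k, `|tnth v k| <= rho) ->
    (lebd R d (A `\` [set x | A (tadd x v)]) <= e%:E)%E.
Proof.
move=> mA Aoo e0; apply: contrapT => H.
have Hn n : exists v : d.-tuple R, (forall k, `|tnth v k| <= n.+1%:R^-1) /\
    (e%:E < lebd R d (A `\` [set x | A (tadd x v)]))%E.
  apply: contrapT => Hv; apply: H; exists n.+1%:R^-1; first by rewrite invr_gt0.
  move=> v vn; rewrite leNgt; apply/negP => ev; apply: Hv.
  by exists v; split.
have [v vP] := choice Hn.
have : (fun n => lebd R d (A `\` [set x | A (tadd x (v n))])) @ \oo --> 0%E.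
  apply: lebd_shift_cvg => // k; apply/cvgr0Pnorm_le => d0 d0gt.
  near=> n; apply: le_trans ((vP n).1 k) _.
  apply/ltW; near: n; exact: near_infty_natSinv_lt (PosNum d0gt).
move/nneg_cvg0P => /(_ (fun=> measure_ge0 _ _) _ e0) [N _ /(_ N (leqnn N))] /=.
by rewrite leNgt (vP N).2.
Unshelve. all: by end_near. Qed.

Lemma integralZ_indic_lebd (R : realType) d (k : R) (A : set (d.-tuple R)) :
  0 <= k -> measurable A ->
  (\int[lebd R d]_x (k%:E * (\1_A x)%:E) = k%:E * lebd R d A)%E.
Proof.
move=> k0 mA; rewrite ge0_integralZl ?integral_indic ?setIT//.
exact/measurable_EFinP/measurable_indic.
Qed.

(** A substitute for the Lebesgue density theorem in which [x] may depend on the scale [s]. The set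
    [E] of pairs (x, v) with x in [A], v in the box and x + v outside [A] is measured in both
    orders. *)
Lemma lebd_density (R : realType) d (A : set (d.-tuple R)) (kappa : R) :
  measurable A -> (0 < lebd R d A < +oo)%E -> 0 < kappa ->
  exists2 rho : R, 0 < rho & forall s, 0 < s <= rho -> exists x,
    (lebd R d (box [tuple 0%R | _ < d] s `\` [set v | A (tadd x v)])
      <= (kappa * (2 * s) ^+ d)%:E)%E.
Proof.
move=> mA /andP[A0 Aoo] k0.
have Afin : lebd R d A \is a fin_num by rewrite ge0_fin_numE.
pose m := fine (lebd R d A).
have AE : lebd R d A = m%:E by rewrite fineK.
have m0 : 0 < m by rewrite fine_gt0// A0.
have e0 : 0 < kappa * m / 2 by rewrite divr_gt0// mulr_gt0.
have [rho rho0 rhoP] := lebd_shift_small mA Aoo e0.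
exists rho => // s /andP[s0 srho]; apply: contrapT => noX.
set K := kappa * (2 * s) ^+ d in noX.
have K0 : 0 < K by rewrite mulr_gt0// exprn_gt0// mulr_gt0.
set B := box _ s in noX.
have mB : measurable B by exact: measurable_box.
have BE : lebd R d B = ((2 * s) ^+ d)%:E by apply: lebd_box; exact: ltW.
pose E := [set z : d.-tuple R * d.-tuple R | [/\ A z.1, B z.2 & ~ A (tadd z.1 z.2)]].
have mE : measurable E.
  rewrite (_ : E = (A `*` B) `\` ((fun z => tadd z.1 z.2) @^-1` A)).
    apply: measurableD; first exact: measurableX.
    by rewrite -[X in measurable X]setTI; exact: measurable_tadd2.
  by apply/seteqP; split=> z /= [] => [a b c|[a b] c].
have := integral_section_swap (lebd R d) (lebd R d) mE.
apply/eqP; rewrite gt_eqF//.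
(* For fixed [v] in the box, the section is the loss of [A] under a small translation, at most
   [kappa * m / 2]. *)
apply: (@le_lt_trans _ _ (\int[lebd R d]_y ((kappa * m / 2)%:E * (\1_B y)%:E))%E).
  apply: le_integral_ge0 => [x|v]; first exact: measure_ge0.
  rewrite indicE; have [vB|vB] := boolP (v \in B).
    rewrite mule1; apply: (le_trans _ (rhoP v _)); last first.
      move=> k; move/set_mem : vB => /(_ k); rewrite tnth_mktuple subr0.
      by move=> /le_trans; apply.
    apply: le_measure; rewrite ?inE.
    - by have := measurable_ysection v mE; rewrite ysectionE.
    - by apply: measurableD => //; exact: measurable_shift.
    - by move=> x [].
  rewrite mule0 (_ : [set x | _] = set0) ?measure0//.
  by apply/seteqP; split=> // x [_] /mem_set; rewrite (negbTE vB).
rewrite (integralZ_indic_lebd (ltW e0) mB) BE -EFinM.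
(* If no [x] worked, each section over a point of [A] would have measure above [K], for a total of
   at least [K * m], twice the upper bound just obtained. *)
apply: (@lt_le_trans _ _ (K * m)%:E).
  have -> : kappa * m / 2 * (2 * s) ^+ d = K * m / 2 by rewrite /K; ring.
  by rewrite lte_fin; have := mulr_gt0 K0 m0; lra.
rewrite EFinM -AE -(integralZ_indic_lebd (ltW K0) mA).
apply: le_integral_ge0 => [x|x]; first by rewrite mule_ge0// lee_fin// ltW.
rewrite indicE; have [xA|xA] := boolP (x \in A); last by rewrite mule0 measure_ge0.
rewrite mule1 leNgt; apply/negP => Kx; apply: noX; exists x; apply: le_trans (ltW Kx).
apply: le_measure; rewrite ?inE.
- apply: measurableD => //.
  by under eq_set do rewrite taddC; exact: measurable_shift.
- by have := measurable_xsection x mE; rewrite xsectionE.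
- by move=> v [Bv nA]; split=> //; exact/set_mem.
Qed.

(** The sets where f >= 1/(n+1), cut by growing boxes to have finite measure, cover the points where
    f > 0. Were they all null, the integral of [f] would be 0 instead of 1. *)
Lemma density_level_set (R : realType) d (f : d.-tuple R -> R) : is_density f ->
  exists2 c : R, 0 < c & exists2 A : set (d.-tuple R),
    measurable A /\ (0 < lebd R d A < +oo)%E & forall x, A x -> c <= f x.
Proof.
move=> [f0 mf fint].
have mfE : measurable_fun [set: d.-tuple R] (EFin \o f) by exact/measurable_EFinP.
pose A n := [set x | n.+1%:R^-1 <= f x] `&` box [tuple 0 | _ < d] n%:R.
have mA n : measurable (A n).
  apply: measurableI; last exact: measurable_box.
  rewrite (_ : [set x | _] = setT `&` (f @^-1` [set` `[n.+1%:R^-1, +oo[])).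
    exact: mf.
  by rewrite setTI; apply/seteqP; split=> x /=; rewrite in_itv/= andbT.
have [[n An]|nA] := pselect (exists n, (0 < lebd R d (A n))%E).
  exists n.+1%:R^-1; first by rewrite invr_gt0.
  exists (A n); last by move=> x [].
  split=> //; rewrite An/=.
  apply: (@le_lt_trans _ _ (lebd R d (box [tuple 0%R | _ < d] n%:R))).
    by apply: le_measure; rewrite ?inE; [exact: mA|exact: measurable_box|move=> x []].
  by rewrite lebd_box ?ltry.
have A0 n : lebd R d (A n) = 0%E.
  apply/eqP; rewrite eq_le measure_ge0 andbT leNgt; apply/negP => An.
  by apply: nA; exists n.
have : (\int[lebd R d]_x (f x)%:E = 0)%E.
  have <- : (\int[lebd R d]_x `|(EFin \o f) x| = \int[lebd R d]_x (f x)%:E)%E.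
    by apply: eq_integral => x _; rewrite gee0_abs// lee_fin.
  apply/(ae_eq_integral_abs (lebd R d) measurableT mfE).
  have : (lebd R d).-negligible (\bigcup_n A n).
    apply: negligible_bigcup => n; apply/negligibleP; [exact: mA|exact: A0].
  apply: negligibleS => x /= fx; apply: contrapT => nAx; apply: fx => _ /=.
  congr (_%:E); apply/eqP; case: eqVneq => // fx; case: nAx.
  have fx0 : 0 < f x by rewrite lt_def fx f0.
  (* [S] bounds both 1/f(x) and all coordinates, so any integer above it is an index [n] with [x] in
     [A n]. *)
  pose S := (f x)^-1 + \sum_k `|tnth x k|.
  have S1 : (f x)^-1 <= S by rewrite lerDl sumr_ge0.
  have S2 k : `|tnth x k| <= S.
    by rewrite /S (bigD1 k)//= addrCA lerDl addr_ge0 ?invr_ge0// sumr_ge0.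
  exists (Num.truncn S).+1 => //; split=> /= [|k].
    rewrite invf_ple ?posrE//; apply: (le_trans S1).
    by rewrite (le_trans (ltW (truncnS_gt _)))// ler_nat.
  by rewrite tnth_mktuple subr0 (le_trans (S2 k))// (ltW (truncnS_gt _)).
by rewrite -lebintE// fint => /eqP; rewrite onee_eq0.
Qed.

Definition tscale (R : realType) d (r : R) (w : d.-tuple R) : d.-tuple R :=
  [tuple r * tnth w k | k < d].

(** All these boxes lie in the cube of half side [2 * r] around [x], so a single [x] serves every
    [w]: the part of the cube outside [A] is too small to fill more than half of any box, and [f] is
    bounded below on [A]. *)
Lemma box_mass (R : realType) d (f : d.-tuple R -> R) (eta : R) :
  is_density f -> 0 < eta <= 1 ->
  exists2 c : R, 0 < c & exists2 rho : R, 0 < rho &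
    forall r, 0 < r <= rho -> exists x, forall w, (forall k, `|tnth w k| <= 1) ->
      ((c * r ^+ d)%:E <=
        \int[lebd R d]_y ((\1_(box (tadd x (tscale r w)) (r * eta)) y)%:E * (f y)%:E))%E.
Proof.
move=> fd /andP[eta0 eta1].
have [c0 c00 [A [mA Apos] Ac]] := density_level_set fd.
(* This factor times the measure (4r)^d of the large cube is half the measure (2 r eta)^d of a small
   box. *)
have k0 : 0 < (eta / 2) ^+ d / 2 by rewrite divr_gt0// exprn_gt0// divr_gt0.
have [rho0 rho00 rhoP] := lebd_density mA Apos k0.
exists (c0 / 2 * (2 * eta) ^+ d).
  by rewrite mulr_gt0 ?divr_gt0// exprn_gt0// mulr_gt0.
exists (rho0 / 2); first by rewrite divr_gt0.
move=> r /andP[r0 rrho].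
have [|x xP] := rhoP (2 * r); first by apply/andP; split; lra.
exists x => w w1.
set B := box _ (r * eta).
have mB : measurable B by exact: measurable_box.
pose V := (2 * (r * eta)) ^+ d.
have mAB : measurable (A `&` B) by exact: measurableI.
have VAB : ((V / 2)%:E <= lebd R d (A `&` B))%E.
  have : (V%:E <= lebd R d (A `&` B) + (V / 2)%:E)%E.
    have <- : lebd R d (box (tscale r w) (r * eta)) = V%:E.
      by apply: lebd_box; rewrite ltW// mulr_gt0.
    have VE : V / 2 = (eta / 2) ^+ d / 2 * (2 * (2 * r)) ^+ d.
      by rewrite mulrAC -exprMn /V; congr (_ ^+ _ / 2); field.
    rewrite VE; apply: (le_trans _ (leeD2l _ xP)).
    rewrite -(lebd_shift x mAB).
    have m1 := measurable_shift x mAB.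
    have m2 : measurable (box [tuple 0 | _ < d] (2 * r) `\` [set v | A (tadd x v)]).
      apply: measurableD; first exact: measurable_box.
      by under eq_set do rewrite taddC; exact: measurable_shift.
    apply: (le_trans _ (@measureU2 _ _ _ (lebd R d) _ _ m1 m2)).
    apply: le_measure; rewrite ?inE; [exact: measurable_box|exact: measurableU|].
    move=> v Dv; have [Av|nAv] := pselect (A (tadd x v)).
      left; split=> /=; first by rewrite taddC.
      move=> k; have := Dv k; rewrite !tnth_mktuple.
      by rewrite (_ : tnth v k + _ - _ = tnth v k - r * tnth w k)//; ring.
    right; split=> // k; have := Dv k; rewrite !tnth_mktuple subr0 => H.
    rewrite -[tnth v k](subrK (r * tnth w k)).
    apply: (le_trans (ler_normD _ _)); rewrite mulr2n mulrDl mul1r.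
    apply: lerD; first by rewrite (le_trans H)// ler_piMr// ltW.
    by rewrite normrM gtr0_norm// ler_piMr// ltW.
  rewrite -leeBlDr// -EFinB; apply: le_trans.
  by rewrite lee_fin; lra.
apply: (@le_trans _ _ (c0%:E * lebd R d (A `&` B))%E).
  apply: (@le_trans _ _ (c0%:E * (V / 2)%:E)%E).
    rewrite -EFinM lee_fin /V !exprMn le_eqVlt; apply/orP; left; apply/eqP; ring.
  by apply: lee_pmul => //; rewrite lee_fin ltW// divr_gt0// exprn_gt0// !mulr_gt0.
rewrite -(integralZ_indic_lebd (ltW c00) mAB).
apply: le_integral_ge0 => y; first by rewrite mule_ge0// lee_fin// ltW.
rewrite -!EFinM lee_fin !indicE; have [yAB|yAB] := boolP (y \in A `&` B).
  have [Ay By] := set_mem yAB.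
  by rewrite mulr1 (mem_set By) mul1r Ac.
by rewrite mulr0 mulr_ge0//; have [] := fd.
Qed.

(** * Packings and induced stars *)

(** The square of [eucl_dist], which keeps distance comparisons polynomial. *)
Definition sqdist (R : realType) d (x y : d.-tuple R) : R :=
  \sum_(k < d) (tnth x k - tnth y k) ^+ 2.

Lemma eucl_dist_le (R : realType) d (x y : d.-tuple R) (r : R) : 0 < r ->
  (eucl_dist x y <= r) = (sqdist x y <= r ^+ 2).
Proof.
move=> r0; rewrite /eucl_dist -[X in _ <= X](gtr0_norm r0) -sqrtr_sqr.
by rewrite ler_sqrt// sqr_ge0.
Qed.

(** The closed ball and the strict separation mirror the graph: adjacency to the centre is a closed
    condition, non-adjacency of two leaves an open one. *)
Definition packing (R : realType) d m :=
  exists w : 'I_m -> d.-tuple R,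
    (forall i, \sum_(k < d) tnth (w i) k ^+ 2 <= 1) /\
    (forall i j, i != j -> 1 < sqdist (w i) (w j)).

Lemma sqr_le_sum (R : realType) d (x : 'I_d -> R) k : x k ^+ 2 <= \sum_k x k ^+ 2.
Proof. by rewrite (bigD1 k)//= lerDl sumr_ge0// => i _; exact: sqr_ge0. Qed.

Lemma coord_le1 (R : realType) d (x : d.-tuple R) k :
  \sum_(k < d) tnth x k ^+ 2 <= 1 -> `|tnth x k| <= 1.
Proof.
move=> x1; rewrite -[leRHS](normr1 R) -ler_sqr ?nnegrE// !real_normK ?num_real//.
by rewrite expr1n (le_trans _ x1)// (@sqr_le_sum _ _ (tnth x)).
Qed.

(** Pigeonhole on a grid of mesh 1/(d+1): two points in one cell have squared distance at most
    d/(d+1), so the map [g] from points to cells is injective. *)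
Lemma packing_bound (R : realType) d m : packing R d m ->
  (m <= #|{ffun 'I_d -> 'I_(2 * d.+1).+1}|)%N.
Proof.
move=> [w [w1 w2]].
pose u i k : R := (tnth (w i) k + 1) * d.+1%:R.
have u0 i k : 0 <= u i k.
  by rewrite mulr_ge0//; have := coord_le1 k (w1 i); rewrite ler_norml; lra.
have uB i k : u i k <= (2 * d.+1)%:R.
  rewrite natrM ler_wpM2r//; have := coord_le1 k (w1 i); rewrite ler_norml; lra.
(* [u i k] attains [2 * d.+1] at coordinate 1, hence one extra cell per direction. *)
pose g i : {ffun 'I_d -> 'I_(2 * d.+1).+1} := [ffun k => inord (Num.truncn (u i k))].
have uS i k : (Num.truncn (u i k) < (2 * d.+1).+1)%N.
  rewrite ltnS -(@ler_nat R); apply: le_trans (uB i k).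
  by rewrite truncn_le.
suff ginj : injective g by have := leq_card g ginj; rewrite card_ord.
move=> i j gij; apply/eqP; apply: contraT => ij.
have uij k : `|u i k - u j k| <= 1.
  have : Num.truncn (u i k) = Num.truncn (u j k).
    by have := congr1 (fun h : {ffun _ -> _} => nat_of_ord (h k)) gij; rewrite !ffunE !inordK.
  have /andP[] := truncn_itv (u0 i k); have /andP[] := truncn_itv (u0 j k).
  by rewrite ler_norml => + + + + E; rewrite E -natr1; lra.
have := w2 _ _ ij; rewrite ltNge => /negP; case.
apply: (@le_trans _ _ (\sum_(k < d) d.+1%:R^-1)); last first.
  rewrite sumr_const card_ord -[leLHS]mulr_natl ler_pdivrMr// mul1r ler_nat//.
apply: ler_sum => k _.
have h : `|tnth (w i) k - tnth (w j) k| <= d.+1%:R^-1.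
  have := uij k; rewrite /u -mulrBl normrM (ger0_norm (ler0n _ _)) -ler_pdivlMr// mul1r.
  by rewrite (_ : _ + 1 - _ = tnth (w i) k - tnth (w j) k)//; ring.
rewrite -real_normK ?num_real// expr2 (le_trans (ler_pM _ _ h h))//.
by rewrite -[leRHS]mulr1 ler_wpM2l// invf_le1// ler1n.
Qed.

Lemma packing1 (R : realType) : packing R 1 2.
Proof.
exists (fun i => [tuple (-1) ^+ i]); split=> [i|i j ij].
  by rewrite big_ord1 tnth0 sqrr_sign.
rewrite /sqdist big_ord1 !tnth0.
case: i ij => [[|[|//]] i]; case: j => [[|[|//]] j] //= _;
  rewrite ?expr0 ?expr1 ?opprK; nra.
Qed.

(** The old points move to the hyperplane of first coordinate 0 and the new one is the basis vector
    [e], at squared distance 1 + |x|^2 from an old point x; this exceeds 1 unless x is the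
    origin. *)
Lemma packingS (R : realType) d m : (1 < m)%N -> packing R d m -> packing R d.+1 m.+1.
Proof.
move=> m1 [w [w1 w2]].
(* A point at the origin would be within distance 1 of any other, and [1 < m] supplies another. *)
have wpos i : 0 < \sum_(k < d) tnth (w i) k ^+ 2.
  rewrite lt_def sumr_ge0 ?andbT; last by move=> k _; exact: sqr_ge0.
  apply/negP => /eqP wi0.
  have [j ij] : exists j : 'I_m, i != j.
    case: m m1 w w1 w2 i wi0 => [//|[//|m]] _ w w1 w2 i _.
    by case: (eqVneq i ord0) => [->|i0]; [exists ord_max|exists ord0].
  have := w2 _ _ ij; rewrite ltNge => /negP; apply; apply: le_trans (w1 j).
  apply: ler_sum => k _; have := @sqr_le_sum _ _ (tnth (w i)) k.
  rewrite wi0 => H; have /eqP : tnth (w i) k ^+ 2 = 0.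
    by apply/eqP; rewrite eq_le H sqr_ge0.
  by rewrite sqrf_eq0 => /eqP ->; rewrite sub0r sqrrN.
pose e : d.+1.-tuple R := cons_tuple 1 [tuple 0 | _ < d].
have sume (x : d.-tuple R) : sqdist e (cons_tuple 0 x) = 1 + \sum_(k < d) tnth x k ^+ 2.
  rewrite /sqdist big_ord_recl !tnth0 subr0 expr1n; congr (_ + _).
  by apply: eq_bigr => k _; rewrite !tnthS tnth_mktuple sub0r sqrrN.
have sqdistC (x y : d.+1.-tuple R) : sqdist x y = sqdist y x.
  by apply: eq_bigr => k _; rewrite -sqrrN opprB.
exists (fun i => if unlift ord0 i is Some j then cons_tuple 0 (w j) else e).
split=> [i|i j].
  case: unliftP => [j|] _.
    rewrite big_ord_recl tnth0 expr0n add0r; apply: le_trans (w1 j).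
    by apply: ler_sum => k _; rewrite tnthS.
  rewrite big_ord_recl tnth0 expr1n big1 ?addr0// => k _.
  by rewrite tnthS tnth_mktuple expr0n.
case: (unliftP ord0 i) => [i'|] ->; case: (unliftP ord0 j) => [j'|] -> //.
- rewrite (inj_eq lift_inj) => ij; apply: (lt_le_trans (w2 _ _ ij)).
  by rewrite /sqdist [leRHS]big_ord_recl !tnth0 subrr expr0n add0r le_eqVlt;
    apply/orP; left; apply/eqP/eq_bigr => k _; rewrite !tnthS.
- by rewrite sqdistC sume ltrDl.
- by rewrite sume ltrDl.
Qed.

Lemma lower_gap (R : realType) (I : finType) (F : I -> R) :
  (forall i, 1 < F i) -> exists2 g : R, 1 < g & forall i, g <= F i.
Proof.
move=> F1; exists (\big[Order.min/2]_i F i)%O; last by move=> i; exact: bigmin_le.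
by apply: lt_bigmin => //; lra.
Qed.

(* The witness w is the packing shrunk towards the origin by the factor
   t = (1 + 1/g) / 2, where g > 1 bounds the squared distances from below:
   then t < 1 and t^2 g > 1. *)
Lemma packing_stable (R : realType) d m : packing R d m ->
  exists (w : 'I_m -> d.-tuple R) (eta : R),
    [/\ 0 < eta <= 1, forall i k, `|tnth (w i) k| <= 1 &
      forall (z0 : d.-tuple R) (z : 'I_m -> d.-tuple R),
        (forall k, `|tnth z0 k| <= eta) ->
        (forall i k, `|tnth (z i) k - tnth (w i) k| <= eta) ->
        (forall i, sqdist z0 (z i) <= 1) /\
        (forall i j, i != j -> 1 < sqdist (z i) (z j))].
Proof.
move=> [w [w1 w2]].
(* Diagonal pairs get the value 2, so that every value exceeds 1. *)
have [|g g1 gP] := @lower_gap R ('I_m * 'I_m)%type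
  (fun p => if p.1 == p.2 then 2 else sqdist (w p.1) (w p.2)).
  by move=> [i j] /=; case: eqVneq => [_|/w2//]; lra.
pose t := (1 + g^-1) / 2.
have gi : 0 < g^-1 < 1 by rewrite invr_gt0 invf_lt1; [apply/andP; split; lra|lra].
have t01 : 0 < t < 1 by rewrite /t; lra.
have tg : 1 < t ^+ 2 * g.
  have g0 : g != 0 by rewrite gt_eqF//; lra.
  have -> : t ^+ 2 * g = (g + 2 + g^-1) / 4 by rewrite /t; field.
  have : 0 < (g - 1) ^+ 2 * g^-1.
    by case/andP: gi => gi0 _; rewrite mulr_gt0// exprn_gt0// subr_gt0.
  have -> : (g - 1) ^+ 2 * g^-1 = g - 2 + g^-1 by field.
  lra.
(* The slack of the shrunk packing: its squared norms are at most [t ^+ 2] and its squared distances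
   at least [t ^+ 2 * g]. *)
pose sl := Num.min (1 - t ^+ 2) (t ^+ 2 * g - 1).
have t2 : 0 < t ^+ 2 < 1 by rewrite exprn_gt0 ?expr_lt1//; lra.
have sl0 : 0 < sl by rewrite lt_min; apply/andP; split; lra.
have sl1 : sl <= 1 - t ^+ 2 by rewrite /sl ge_min lexx.
have sl2 : sl <= t ^+ 2 * g - 1 by rewrite /sl ge_min lexx orbT.
(* A difference of two perturbed points moves by at most [2 * eta] per coordinate; each square then
   changes by at most [2 * eta * 6], and their sum by at most [sl / 2]. *)
pose eta := sl / (24 * d.+1%:R).
have eta0 : 0 < eta by rewrite divr_gt0// mulr_gt0.
have etaE : 24 * (d.+1%:R * eta) = sl.
  by rewrite /eta mulrA mulrCA divff ?mulr1// mulf_neq0.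
have eta1 : eta <= 1.
  have : eta <= d.+1%:R * eta by rewrite ler_peMl ?ler1n// ltW.
  lra.
pose v i : d.-tuple R := [tuple t * tnth (w i) k | k < d].
have v1 i k : `|tnth (v i) k| <= 1.
  rewrite tnth_mktuple normrM gtr0_norm; last by lra.
  by rewrite mulr_ile1//; [lra|lra|exact: coord_le1].
have key (a b : 'I_d -> R) :
    (forall k, `|a k| <= 2) -> (forall k, `|b k - a k| <= 2 * eta) ->
    `|\sum_k b k ^+ 2 - \sum_k a k ^+ 2| <= sl / 2.
  move=> a2 ba; rewrite -sumrB; apply: (le_trans (ler_norm_sum _ _ _)).
  apply: (@le_trans _ _ (\sum_(k < d) 12 * eta)).
    apply: ler_sum => k _.
    have -> : b k ^+ 2 - a k ^+ 2 = (b k - a k) * (2 * a k + (b k - a k)) by ring.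
    rewrite normrM.
    have h1 : `|2 * a k + (b k - a k)| <= 6.
      apply: (le_trans (ler_normD _ _)); rewrite normrM (ger0_norm (ler0n _ 2)).
      by have := a2 k; have := ba k; lra.
    by apply: (le_trans (ler_pM _ _ (ba k) h1)) => //; lra.
  rewrite sumr_const card_ord -[leLHS]mulr_natl.
  have : d%:R * eta <= d.+1%:R * eta by rewrite ler_wpM2r ?ler_nat// ltW.
  lra.
exists v, eta; split=> //; first by rewrite eta0.
move=> z0 z hz0 hz; split=> [i|i j ij].
  have k1 : \sum_k tnth (v i) k ^+ 2 <= t ^+ 2.
    under eq_bigr do rewrite tnth_mktuple exprMn.
    by rewrite -mulr_sumr ler_piMr// sqr_ge0.
  have := key (fun k => tnth (v i) k) (fun k => tnth (z i) k - tnth z0 k).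
  have -> : sqdist z0 (z i) = \sum_k (tnth (z i) k - tnth z0 k) ^+ 2.
    by apply: eq_bigr => k _; rewrite -sqrrN opprB.
  have h1 k : `|tnth (v i) k| <= 2 by apply: (le_trans (v1 i k)); lra.
  have h2 k : `|tnth (z i) k - tnth z0 k - tnth (v i) k| <= 2 * eta.
    by have := hz i k; have := hz0 k; rewrite !ler_norml; lra.
  by move=> /(_ h1 h2)/ler_normlP[_]; lra.
have k1 : t ^+ 2 * g <= \sum_k (tnth (v i) k - tnth (v j) k) ^+ 2.
  have := gP (i, j); rewrite /= (negbTE ij) => gij.
  apply: (@le_trans _ _ (t ^+ 2 * sqdist (w i) (w j))).
    by rewrite ler_wpM2l// sqr_ge0.
  rewrite /sqdist mulr_sumr le_eqVlt; apply/orP; left; apply/eqP/eq_bigr => k _.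
  by rewrite !tnth_mktuple -mulrBr [RHS]exprMn.
have := key (fun k => tnth (v i) k - tnth (v j) k) (fun k => tnth (z i) k - tnth (z j) k).
have h1 k : `|tnth (v i) k - tnth (v j) k| <= 2.
  by have := v1 i k; have := v1 j k; rewrite !ler_norml; lra.
have h2 k : `|tnth (z i) k - tnth (z j) k - (tnth (v i) k - tnth (v j) k)| <= 2 * eta.
  by have := hz i k; have := hz j k; rewrite !ler_norml; lra.
by move=> /(_ h1 h2)/ler_normlP[+ _]; rewrite /sqdist; lra.
Qed.

Lemma packing_le (R : realType) d m m' : (m' <= m)%N -> packing R d m -> packing R d m'.
Proof.
move=> mm [w [w1 w2]]; exists (fun i => w (widen_ord mm i)); split=> [i|i j ij] //.
exact: w2.
Qed.

Lemma max_packing_ex (R : realType) d :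
  exists M, packing R d M /\ forall m, packing R d m -> (m <= M)%N.
Proof.
have ex0 : exists m, `[< packing R d m >].
  by exists 0%N; apply/asboolP; exists (fun=> [tuple 0 | _ < d]); split=> [] [].
have bnd m : `[< packing R d m >] -> (m <= #|{ffun 'I_d -> 'I_(2 * d.+1).+1}|)%N.
  by move/asboolP; exact: packing_bound.
case: (ex_maxnP ex0 bnd) => M /asboolP MP Mmax.
by exists M; split=> // m mP; apply: Mmax; apply/asboolP.
Qed.

Definition max_packing (R : realType) d : nat := projT1 (cid (max_packing_ex R d)).

Lemma packing_max_packing (R : realType) d : packing R d (max_packing R d).
Proof. by rewrite /max_packing; case: cid => M []. Qed.

Lemma le_max_packing (R : realType) d m : packing R d m -> (m <= max_packing R d)%N.
Proof. by rewrite /max_packing; case: cid => M [] /= _; exact. Qed.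

Lemma max_packing_gt1 (R : realType) d : (0 < d)%N -> (1 < max_packing R d)%N.
Proof.
case: d => // d _; elim: d => [|d IH]; first exact/le_max_packing/packing1.
apply: (leq_trans IH); apply: le_max_packing; apply: packing_le (leqnSn _) _.
exact: packingS IH (packing_max_packing R d.+1).
Qed.

Lemma max_packing_homo (R : realType) d d' : (0 < d)%N -> (d < d')%N ->
  (max_packing R d < max_packing R d')%N.
Proof.
move=> d0; elim: d' => // d' IH; rewrite ltnS leq_eqVlt => /predU1P[<-|dd'].
  apply: le_max_packing; apply: packingS; first exact: max_packing_gt1.
  exact: packing_max_packing.
apply: (ltn_trans (IH dd')); apply: le_max_packing; apply: packingS.
  by apply: max_packing_gt1; exact: ltn_trans dd'.
exact: packing_max_packing.
Qed.

(** Leaves are required to be distinct explicitly, since with an empty diagonal a vertex is not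
    adjacent to itself. *)
Definition induced_star n (G : 'M[bool]_n) m :=
  exists (c : 'I_n) (l : 'I_m -> 'I_n),
    (forall i, G c (l i)) /\
    (forall i j, i != j -> l i != l j /\ ~~ G (l i) (l j)).

Lemma induced_star_le n (G : 'M[bool]_n) m m' :
  (m' <= m)%N -> induced_star G m -> induced_star G m'.
Proof.
move=> mm [c [l [l1 l2]]]; exists c, (fun i => l (widen_ord mm i)).
by split=> [i|i j ij] //; exact: l2.
Qed.

(** Move the centre of the star to the origin and divide by [r]: edges put the leaves in the unit
    ball, non-edges separate them by more than 1. *)
Lemma induced_star_packing (R : realType) n d (r : R) (xs : n.-tuple (d.-tuple R)) m :
  0 < r -> induced_star (rgg_adj r xs) m -> packing R d m.
Proof.
move=> r0 [c [l [l1 l2]]].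
pose w i : d.-tuple R :=
  [tuple (tnth (tnth xs (l i)) k - tnth (tnth xs c) k) / r | k < d].
exists w; split=> [i|i j ij].
  have := l1 i; rewrite mxE eucl_dist_le// => /andP[_ H].
  under eq_bigr do rewrite tnth_mktuple exprMn -sqrrN opprB.
  by rewrite -mulr_suml exprVn ler_pdivrMr ?exprn_gt0// mul1r.
have [lij] := l2 _ _ ij; rewrite mxE lij /= eucl_dist_le// -ltNge => H.
rewrite /sqdist.
under eq_bigr do rewrite !tnth_mktuple -mulrBl exprMn opprB addrA subrK.
by rewrite -mulr_suml exprVn ltr_pdivlMr ?exprn_gt0// mul1r.
Qed.

(** If one dimension were smaller, its M plus one would be at most the M of the other by strict
    monotonicity, and the larger star would contain a forbidden one. *)
Lemma max_packing_unique (R : realType) n (G : 'M[bool]_n) d d' :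
  (0 < d)%N -> (0 < d')%N ->
  induced_star G (max_packing R d) -> ~ induced_star G (max_packing R d).+1 ->
  induced_star G (max_packing R d') -> ~ induced_star G (max_packing R d').+1 ->
  d = d'.
Proof.
move=> d0 d'0 s1 ns1 s2 ns2; apply/eqP; rewrite eqn_leq; apply/andP; split.
  rewrite leqNgt; apply/negP => dd; apply: ns2.
  exact: (induced_star_le (max_packing_homo R d'0 dd)).
rewrite leqNgt; apply/negP => dd; apply: ns1.
exact: (induced_star_le (max_packing_homo R d0 dd)).
Qed.

(** * Sampling *)

Lemma iterint_ge0 (R : realType) (T : Type) (I : (T -> \bar R) -> \bar R) n
    (h : n.-tuple T -> \bar R) :
  (forall g, (forall x, 0 <= g x)%E -> (0 <= I g)%E) ->
  (forall t, 0 <= h t)%E -> (0 <= @iterint R T I n h)%E.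
Proof.
move=> I0; elim: n h => [|n IH] h h0 /=; first exact: h0.
by apply: I0 => x; apply: IH => t.
Qed.

Lemma iterint_le (R : realType) (T : Type) (I : (T -> \bar R) -> \bar R) n
    (h h' : n.-tuple T -> \bar R) :
  (forall g, (forall x, 0 <= g x)%E -> (0 <= I g)%E) ->
  (forall g g', (forall x, 0 <= g x)%E -> (forall x, g x <= g' x)%E -> (I g <= I g')%E) ->
  (forall t, 0 <= h t)%E -> (forall t, h t <= h' t)%E ->
  (@iterint R T I n h <= @iterint R T I n h')%E.
Proof.
move=> I0 Imono; elim: n h h' => [|n IH] h h' h0 hh' /=; first exact: hh'.
apply: Imono => x; first by apply: iterint_ge0.
by apply: IH => t.
Qed.

Lemma lebint_ge0 (R : realType) d (g : d.-tuple R -> \bar R) :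
  (forall x, 0 <= g x)%E -> (0 <= lebint g)%E.
Proof. by apply: iterint_ge0 => h h0; exact: integral_ge0. Qed.

Lemma lebint_le (R : realType) d (g g' : d.-tuple R -> \bar R) :
  (forall x, 0 <= g x)%E -> (forall x, g x <= g' x)%E -> (lebint g <= lebint g')%E.
Proof.
apply: iterint_le => [h h0|h h' h0 hh']; first exact: integral_ge0.
exact: le_integral_ge0.
Qed.

Lemma iid_expect_le (R : realType) n d (f : d.-tuple R -> R)
    (h h' : n.-tuple (d.-tuple R) -> \bar R) : (forall x, 0 <= f x) ->
  (forall t, 0 <= h t)%E -> (forall t, h t <= h' t)%E ->
  (iid_expect f h <= iid_expect f h')%E.
Proof.
move=> f0; apply: iterint_le => [g g0|g g' g0 gg'].
  by apply: lebint_ge0 => x; rewrite mule_ge0// lee_fin.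
apply: lebint_le => x; first by rewrite mule_ge0// lee_fin.
by rewrite lee_wpmul2r// lee_fin.
Qed.

(** Fixing the first point leaves a function of the same form with weights [c i * phi i x]; hence
    the induction runs over all nonnegative weights [c]. *)
Lemma iid_expect_sum_prod (R : realType) n d M (f : d.-tuple R -> R)
    (phi : 'I_M -> d.-tuple R -> R) (c q : 'I_M -> R) :
  is_density f -> (forall i x, 0 <= phi i x) ->
  (forall i, measurable_fun [set: d.-tuple R] (phi i)) ->
  (forall i, 0 <= c i) -> (forall i, 0 <= q i) ->
  (forall i, \int[lebd R d]_x (phi i x * f x)%:E = (q i)%:E)%E ->
  iid_expect f (fun xs : n.-tuple (d.-tuple R) =>
    (\sum_(i < M) c i * \prod_(j < n) phi i (tnth xs j))%:E)
  = (\sum_(i < M) c i * q i ^+ n)%:E.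
Proof.
move=> [f0 mf _] phi0 mphi + q0 qE; elim: n c => [|n IH] c c0.
  by rewrite /iid_expect /=; congr (_%:E); apply: eq_bigr => i _; rewrite big_ord0.
have step x : iid_expect f (fun t : n.-tuple (d.-tuple R) =>
    (\sum_(i < M) c i * \prod_(j < n.+1) phi i (tnth (cons_tuple x t) j))%:E)
    = (\sum_(i < M) (c i * phi i x) * q i ^+ n)%:E.
  rewrite -IH => [|i]; last by rewrite mulr_ge0.
  congr (iid_expect f _); apply/funext => t; congr (_%:E); apply: eq_bigr => i _.
  rewrite big_ord_recl tnth0 mulrA; congr (_ * _).
  by apply: eq_bigr => j _; rewrite tnthS.
rewrite /iid_expect /=.
pose G i x := ((c i * q i ^+ n)%:E * (phi i x * f x)%:E)%E.
have mG i : measurable_fun [set: d.-tuple R] (fun x => (phi i x * f x)%:E).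
  by apply/measurable_EFinP/measurable_funM.
transitivity (lebint (fun x => \sum_(i < M) G i x)%E).
  congr lebint; apply/funext => x; rewrite [X in (X * _)%E]step.
  transitivity (((\sum_(i < M) c i * phi i x * q i ^+ n) * f x)%:E); first by [].
  transitivity (\sum_(i < M) (c i * q i ^+ n * (phi i x * f x))%:E)%E; last by [].
  rewrite sumEFin mulr_suml; congr (_%:E); apply: eq_bigr => i _; ring.
have cq0 i : (0 <= (c i * q i ^+ n)%:E)%E by rewrite lee_fin mulr_ge0// exprn_ge0.
have G0 i x : (0 <= G i x)%E by rewrite mule_ge0// lee_fin mulr_ge0.
rewrite lebintE; last 2 first.
- by apply: emeasurable_sum => i; exact: measurable_funeM.
- by move=> x; apply: sume_ge0 => i _.
rewrite ge0_integral_sum//; last by move=> i; exact: measurable_funeM.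
rewrite -sumEFin; apply: eq_bigr => i _.
rewrite ge0_integralZl//; last by move=> x _; rewrite lee_fin mulr_ge0.
by rewrite qE -EFinM exprSr mulrA.
Qed.

(** The product [(1 - p) ^+ n * (1 + n%:R * p)] does not increase with [n], because (1 - p)(1 +
    (n+1)p) <= 1 + np. *)
Lemma expr1B_le (R : realType) (p : R) n :
  0 <= p <= 1 -> (1 - p) ^+ n <= (1 + n%:R * p)^-1.
Proof.
move=> /andP[p0 p1]; have np : 0 < 1 + n%:R * p by rewrite ltr_pwDl// mulr_ge0.
rewrite -[leRHS]mul1r ler_pdivlMr//.
elim: n np => [|n IH] np; first by rewrite mul0r addr0 mulr1.
have np' : 0 < 1 + n%:R * p by rewrite ltr_pwDl// mulr_ge0.
apply: le_trans (IH np'); rewrite exprSr -mulrA ler_wpM2l//.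
  by rewrite exprn_ge0// subr_ge0.
have : 0 <= n%:R * p * p by rewrite !mulr_ge0.
by rewrite -natr1; nra.
Qed.

Definition hit_boxes (R : realType) n d (xs : n.-tuple (d.-tuple R)) M
    (b : 'I_M -> d.-tuple R) (s : R) :=
  forall i, exists j, box (b i) s (tnth xs j).

(** A union bound: the arbitrary event [E] is dominated pointwise by a measurable sum over the
    boxes, whose expectation is the sum of the n-th powers of the masses outside each box. *)
Lemma prob_miss_boxes (R : realType) n d M (f : d.-tuple R -> R)
    (b : 'I_M -> d.-tuple R) (s p : R) (E : n.-tuple (d.-tuple R) -> bool) :
  is_density f -> 0 <= p ->
  (forall i, p%:E <= \int[lebd R d]_y ((\1_(box (b i) s) y)%:E * (f y)%:E))%E ->
  (forall xs, hit_boxes xs b s -> ~~ E xs) ->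
  (iid_expect f (fun xs => (if E xs then 1 else 0)%:E) <=
    (M%:R * (1 + n%:R * p)^-1)%:E)%E.
Proof.
move=> fd p0 pP EP; have [f0 mf fint] := fd.
have m1 i : measurable_fun [set: d.-tuple R] (\1_(box (b i) s) : _ -> R).
  by apply: measurable_indic; exact: measurable_box.
pose phi i x : R := 1 - \1_(box (b i) s) x.
have phi0 i x : 0 <= phi i x by rewrite subr_ge0 indicE; case: (_ \in _).
have mphi i : measurable_fun [set: d.-tuple R] (phi i) by exact: measurable_funB.
have mI i : measurable_fun [set: d.-tuple R] (fun x => (\1_(box (b i) s) x * f x)%:E).
  exact/measurable_EFinP/measurable_funM.
have mJ i : measurable_fun [set: d.-tuple R] (fun x => (phi i x * f x)%:E).
  exact/measurable_EFinP/measurable_funM.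
have tot i : (\int[lebd R d]_y (\1_(box (b i) s) y * f y)%:E +
    \int[lebd R d]_y (phi i y * f y)%:E = 1)%E.
  rewrite -ge0_integralD//; last 2 first.
  - by move=> x _; rewrite lee_fin mulr_ge0.
  - by move=> x _; rewrite lee_fin mulr_ge0.
  rewrite -fint lebintE//; [|exact/measurable_EFinP].
  by apply: eq_integral => x _; rewrite -EFinD; congr (_%:E); rewrite /phi; ring.
have I0 i : (0 <= \int[lebd R d]_y (\1_(box (b i) s) y * f y)%:E)%E.
  by apply: integral_ge0 => x _; rewrite lee_fin mulr_ge0.
have J0 i : (0 <= \int[lebd R d]_y (phi i y * f y)%:E)%E.
  by apply: integral_ge0 => x _; rewrite lee_fin mulr_ge0.
pose q i := fine (\int[lebd R d]_x (phi i x * f x)%:E)%E.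
have qE i : (\int[lebd R d]_x (phi i x * f x)%:E = (q i)%:E)%E.
  rewrite fineK// ge0_fin_numE//; apply: (@le_lt_trans _ _ 1%E); last exact: ltry.
  by rewrite -(tot i) leeDr.
have q0 i : 0 <= q i by rewrite fine_ge0.
have qp i : q i <= 1 - p.
  rewrite lerBrDl -lee_fin EFinD -qE -(tot i) leeD2r//.
  by apply: (le_trans (pP i)).
(* When [E] holds, some box is missed by every point and its product equals 1. *)
have h1 xs : ((if E xs then 1 else 0)%:E <=
    (\sum_(i < M) 1 * \prod_(j < n) phi i (tnth xs j))%:E :> \bar R)%E.
  rewrite lee_fin; have P0 i : 0 <= 1 * \prod_(j < n) phi i (tnth xs j).
    by rewrite mul1r; apply: prodr_ge0.
  case: ifPn => [Exs|_]; last exact: sumr_ge0.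
  have [i iP] : exists i, forall j, ~ box (b i) s (tnth xs j).
    apply: contrapT => H; have hit : hit_boxes xs b s.
      move=> i; apply: contrapT => Hi; apply: H; exists i => j bj.
      by apply: Hi; exists j.
    by have := EP _ hit; rewrite Exs.
  rewrite (bigD1 i)//= -[leLHS]addr0 lerD ?sumr_ge0//.
  by rewrite mul1r big1// => j _; rewrite /phi indicE memNset ?subr0.
apply: (@le_trans _ _ (\sum_(i < M) 1 * q i ^+ n)%:E).
  rewrite -(iid_expect_sum_prod n fd phi0 mphi (fun=> ler01) q0 qE).
  by apply: iid_expect_le => // t; rewrite lee_fin; case: ifP.
rewrite lee_fin -[X in X%:R * _]card_ord mulr_natl -sumr_const; apply: ler_sum => i _.
rewrite mul1r; apply: le_trans (expr1B_le n _); last first.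
  by rewrite p0 -subr_ge0 (le_trans (q0 i)).
by rewrite lerXn2r// nnegrE// (le_trans (q0 i)).
Qed.

(* The box of index 0 is that of the centre of the star. *)
Lemma boxes_induced_star (R : realType) d : (0 < d)%N ->
  exists (w : 'I_(max_packing R d).+1 -> d.-tuple R) (eta : R),
    [/\ 0 < eta <= 1, forall i k, `|tnth (w i) k| <= 1 &
      forall n (xs : n.-tuple (d.-tuple R)) (r : R) (x : d.-tuple R), 0 < r ->
        hit_boxes xs (fun i => tadd x (tscale r (w i))) (r * eta) ->
        induced_star (rgg_adj r xs) (max_packing R d)].
Proof.
move=> d0; have [w [eta [eta01 w1 wP]]] := packing_stable (packing_max_packing R d).
set M := max_packing R d in w w1 wP *.
have M1 : (1 < M)%N := max_packing_gt1 R d0.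
exists (fun i => if unlift ord0 i is Some j then w j else [tuple 0 | _ < d]), eta.
split=> // [i k|n xs r x r0 hit].
  by case: unliftP => [j|] _ //; rewrite tnth_mktuple normr0.
have [J JP] := choice hit.
pose c := J ord0; pose l i := J (lift ord0 i).
pose z j : d.-tuple R := [tuple (tnth (tnth xs j) k - tnth x k) / r | k < d].
have zE i j : sqdist (z i) (z j) = sqdist (tnth xs i) (tnth xs j) / r ^+ 2.
  rewrite /sqdist mulr_suml; apply: eq_bigr => k _.
  by rewrite !tnth_mktuple; field; rewrite gt_eqF.
have zbox a (u : R) : `|a - u * r| <= r * eta -> `|a / r - u| <= eta.
  rewrite (mulrC r) -ler_pdivrMr// -[X in _ / X](gtr0_norm r0) -normf_div.
  by rewrite mulrBl mulfK// gt_eqF.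
have [|i k|zc zl] := wP (z c) (fun i => z (l i)).
- move=> k; have := JP ord0 k; rewrite unlift_none !tnth_mktuple mulr0 addr0 => H.
  by rewrite -[X in `|X|]subr0; apply: zbox; rewrite mul0r subr0.
- have := JP (lift ord0 i) k; rewrite liftK !tnth_mktuple => H.
  by apply: zbox; rewrite mulrC; move: H; rewrite opprD addrA.
have r20 : 0 < r ^+ 2 by rewrite exprn_gt0.
exists c, l; split=> [i|i j ij].
  rewrite mxE eucl_dist_le//; apply/andP; split; last first.
    by have := zc i; rewrite zE ler_pdivrMr// mul1r.
  (* Were the centre the leaf [i], another leaf [j], which exists as [1 < M], would be at rescaled
     distance both at most 1 and greater than 1 from it. *)
  apply/eqP => cl.
  have [j ij] : exists j : 'I_M, i != j.
    move: i {cl}; case: M M1 {w w1 wP hit J JP c l zc zl} => [//|[//|m]] _ i.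
    by case: (eqVneq i ord0) => [->|i0]; [exists ord_max|exists ord0].
  by have := zl _ _ ij; rewrite -cl ltNge zc.
have := zl _ _ ij; rewrite zE ltr_pdivlMr// mul1r => H; split.
  apply/eqP => lij; move: H; rewrite lij /sqdist big1 => [|k _].
    by rewrite ltNge (ltW r20).
  by rewrite subrr expr0n.
by rewrite mxE eucl_dist_le// leNgt H andbF.
Qed.

(** * The estimator and its consistency *)

(** The value is 0 when the largest star has a number of leaves that is no M(d). The argument [u]
    ranges over a single element, so the estimator is deterministic. *)
Definition dim_estimator (R : realType) n (u : 'I_1) (G : 'M[bool]_n) : R :=
  (xget 0%N [set d | [/\ (0 < d)%N, induced_star G (max_packing R d)
                       & ~ induced_star G (max_packing R d).+1]])%:R.

(** No graph drawn in R^d has an induced star with more than M(d) leaves, so exhibiting one with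
    M(d) leaves fixes the value exactly. *)
Lemma dim_estimatorE (R : realType) n d (u : 'I_1) (r : R) (xs : n.-tuple (d.-tuple R)) :
  (0 < d)%N -> 0 < r -> induced_star (rgg_adj r xs) (max_packing R d) ->
  dim_estimator R u (rgg_adj r xs) = d%:R.
Proof.
move=> d0 r0 star.
have nstar : ~ induced_star (rgg_adj r xs) (max_packing R d).+1.
  by move=> /(induced_star_packing r0)/le_max_packing; rewrite ltnn.
rewrite /dim_estimator; congr (_%:R); apply: xget_unique => // d' [d'0 s' ns'].
exact: (@max_packing_unique R n (rgg_adj r xs)).
Qed.

Theorem theorem2 (R : realType) :
  exists (K : nat -> nat) (Delta : forall n : nat, 'I_(K n).+1 -> 'M[bool]_n -> R),
  forall (d : nat) (f : d.-tuple R -> R) (r : nat -> R),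
    (1 <= d)%N ->
    is_density f ->
    (forall n, 0 < r n) ->
    (fun n => n%:R * r n ^+ d) @ \oo --> +oo ->
    r @ \oo --> 0 ->
    forall eps : R, 0 < eps ->
      (fun n => dev_prob f (r n) (Delta n) d%:R eps) @ \oo --> 0%E.
Proof.
exists (fun=> 0%N), (dim_estimator R) => d f r d1 fd r0 nrd rcvg eps eps0.
have f0 : forall x, 0 <= f x by case: fd.
have [w [eta [eta01 w1 wP]]] := boxes_induced_star R d1.
have [c c0 [rho rho0 rhoP]] := box_mass fd eta01.
have devE n : dev_prob f (r n) (@dim_estimator R n) d%:R eps =
    iid_expect f (fun xs : n.-tuple (d.-tuple R) =>
      (if eps < `|dim_estimator R ord0 (rgg_adj (r n) xs) - d%:R| then 1 else 0)%:E).
  by rewrite /dev_prob big_ord1 invr1 mul1e.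
under eq_fun do rewrite devE.
apply/nneg_cvg0P => [n|e e0].
  apply: iterint_ge0 => [g g0|xs]; last by rewrite lee_fin; case: ifP.
  by apply: lebint_ge0 => x; rewrite mule_ge0// lee_fin.
pose M := max_packing R d.
near=> n.
have rn : 0 < r n <= rho.
  rewrite r0/=; apply: le_trans (ler_norm _) _.
  by near: n; apply: (cvgr0_norm_le _ rcvg).
have [x xP] := rhoP _ rn.
have p0 : 0 <= c * r n ^+ d by rewrite mulr_ge0 ?exprn_ge0 ?ltW.
apply: (le_trans (prob_miss_boxes fd p0 (fun i => xP _ (w1 i)) _)).
  move=> xs /(wP _ _ _ _ (r0 n)) star.
  by rewrite (dim_estimatorE _ d1 (r0 n) star) subrr normr0 -leNgt ltW.
(* From this threshold on, the bound (M+1) / (1 + n c r_n^d) is at most [e]; the [M.+1] boxes are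
   those of the leaves and of the centre. *)
have Y : M.+1%:R / e / c <= n%:R * r n ^+ d by near: n; exact: (cvgry_ge nrd).
have np : 0 < 1 + n%:R * (c * r n ^+ d) by rewrite ltr_pwDl// mulr_ge0.
rewrite lee_fin ler_pdivrMr//.
move: Y; rewrite !ler_pdivrMr// => Y; apply: (le_trans Y).
rewrite mulrC ler_wpM2l ?(ltW e0)//.
by rewrite [leLHS](_ : _ = n%:R * (c * r n ^+ d)) ?lerDr//; ring.
Unshelve. all: by end_near. Qed.
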